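(* Let $(d_n)_{n\ge1}$ be a fixed sequence of integers $d_n\ge2$. Let $m\ge1$, let $0<k_1<k_2<\dots<k_m$ be integers and let $c_i\in\{0,1,\dots,d_{k_i}-1\}$ for $i=1,\dots,m$. The Lebesgue measure of the set $\Delta^{k_1k_2\ldots k_m}_{c_1c_2\ldots c_m}$ is $$\lambda\left(\Delta^{k_1k_2\ldots k_m}_{c_1c_2\ldots c_m}\right)=\prod_{i=1}^{m}\frac{1}{d_{k_i}}.$$
   Context: Put $a_0=\sum_{n=1}^{\infty}\frac{(-1)^{n+1}}{d_1d_2\cdots d_n}$. For digits $\varepsilon_n\in\{0,\dots,d_n-1\}$ put $\Delta^{-D}_{\varepsilon_1\varepsilon_2\ldots}=\sum_{n=1}^{\infty}\frac{(-1)^n\varepsilon_n}{d_1d_2\cdots d_n}$; every number of $[a_0-1;a_0]$ has such a representation. The set $\Delta^{k_1k_2\ldots k_m}_{c_1c_2\ldots c_m}$ is the set of all numbers of $[a_0-1;a_0]$ having a representation $\Delta^{-D}_{\varepsilon_1\varepsilon_2\ldots}$ with $\varepsilon_{k_i}=c_i$ for all $i=1,\dots,m$. $\lambda$ denotes Lebesgue measure. *)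

(* Defs.v *)
From mathcomp Require Import all_boot all_order all_algebra.
From mathcomp Require Import all_classical all_reals all_analysis.
Import Order.TTheory GRing.Theory Num.Theory numFieldNormedType.Exports.

Set Implicit Arguments.
Unset Strict Implicit.
Unset Printing Implicit Defensive.

Local Open Scope classical_set_scope.
Local Open Scope ring_scope.

(* Sequences are indexed from 1: the values [d 0] and [e 0] are never used. *)

Definition dprod (d : nat -> nat) (n : nat) : nat :=
  (\prod_(1 <= j < n.+1) d j)%N.

Definition a0 (R : realType) (d : nat -> nat) : R :=
  limn (fun N : nat =>
    \sum_(1 <= n < N.+1) ((-1) ^+ n.+1 / (dprod d n)%:R) : R).

Definition digits (d e : nat -> nat) : Prop :=
  forall n, (1 <= n)%N -> (e n < d n)%N.

(* The infinite sums here and in [a0] are limits of partial sums; they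
   converge absolutely as soon as [2 <= d n] for [1 <= n] and [digits d e]. *)
Definition negD (R : realType) (d e : nat -> nat) : R :=
  limn (fun N : nat =>
    \sum_(1 <= n < N.+1) ((-1) ^+ n * (e n)%:R / (dprod d n)%:R) : R).

(* Numbers may have two representations; it is enough that one of them has the
   prescribed digits. *)
Definition Delta_set (R : realType) (d : nat -> nat) (m : nat)
    (k c : 'I_m -> nat) : set R :=
  [set x | a0 R d - 1 <= x <= a0 R d /\
     exists e : nat -> nat, [/\ digits d e, x = negD R d e
                              & forall i : 'I_m, e (k i) = c i]].

Arguments Delta_set R d {m} k c.

(* Main.v *)
Require Import Defs.
From mathcomp Require Import all_boot all_order all_algebra.
From mathcomp Require Import all_classical all_reals all_analysis.
From mathcomp Require Import zify ring lra.
Import Order.TTheory GRing.Theory Num.Theory numFieldNormedType.Exports.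

Local Open Scope classical_set_scope.
Local Open Scope ring_scope.

(** Complementing the digits of odd rank, [f n = d n - 1 - e n] for odd [n] and
[f n = e n] for even [n], turns the alternating series of [e] into the positive
Cantor series [\sum_n f n / dprod d n], shifted by the constant [a0 - 1]
([negDE]). Prescribing digits of [e] amounts to prescribing digits of [f], so
the question is about the translated set of sums of Cantor series whose digits
of rank at most [N] are confined to given sets, [N] being the largest
prescribed rank.

Write [P = dprod d N]. The first [N] digits of [f] determine an integer [a < P],
and the sum lies between [a / P] and [(a + 1) / P] ([cantor_itv]). Conversely,
every [x] in the half-open cell from [a / P] to [(a + 1) / P] is such a sum,
with the digits read off the integer parts of [x * dprod d n]
([cantor_truncn]). Up to finitely many endpoints the set is therefore a disjoint
union of half-open cells of length [1 / P], one for each admissible prefix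
([measure_cantor_cylinder]). A rank [j] contributes one choice of digit if it is
prescribed and [d j] choices otherwise, so dividing the number of prefixes by
[P] leaves the product of the [1 / d (k i)]. *)

(** * The denominators of the expansions *)

Lemma dprod0 (d : nat -> nat) : dprod d 0 = 1%N.
Proof. by rewrite /dprod big_geq. Qed.

Lemma dprodS (d : nat -> nat) (n : nat) :
  dprod d n.+1 = (dprod d n * d n.+1)%N.
Proof. by rewrite /dprod big_nat_recr. Qed.

Lemma ltn_dprod (d : nat -> nat) (n : nat) :
  (forall n, (1 <= n)%N -> (2 <= d n)%N) -> (n < dprod d n)%N.
Proof.
move=> hd; elim: n => [|n IHn]; first by rewrite dprod0.
have hdn : (2 <= d n.+1)%N by exact: hd.
by rewrite dprodS; nia.
Qed.

Lemma dprod_gt0 (R : realType) (d : nat -> nat) (n : nat) :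
  (forall n, (1 <= n)%N -> (2 <= d n)%N) -> 0 < (dprod d n)%:R :> R.
Proof. by move=> hd; rewrite ltr0n (leq_ltn_trans _ (ltn_dprod _ n hd)). Qed.

Lemma cvg_invr_dprod (R : realType) (d : nat -> nat) :
  (forall n, (1 <= n)%N -> (2 <= d n)%N) ->
  (((dprod d n)%:R)^-1 : R) @[n --> \oo] --> (0 : R).
Proof.
move=> hd; apply: (@squeeze_cvgr _ _ _ _ (fun=> 0) harmonic).
- apply: nearW => n; rewrite invr_ge0 ler0n /=.
  by rewrite lef_pV2 ?posrE ?dprod_gt0 ?ltr0n // ler_nat ltn_dprod.
- exact: cvg_cst.
- exact: cvg_harmonic.
Qed.

(** * Cantor series with positive terms *)

(** The numerator over [dprod d n] of the partial sum of rank [n] of a Cantor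
series: the integer with mixed-radix digits [f 1, .., f n]. *)
Fixpoint cantor_num (d f : nat -> nat) (n : nat) : nat :=
  if n is n'.+1 then (cantor_num d f n' * d n + f n)%N else 0%N.

(** The partial sum of ranks 1 to [n] of the Cantor series of [f]. *)
Definition cantor_psum (R : realType) (d f : nat -> nat) (n : nat) : R :=
  \sum_(1 <= j < n.+1) ((f j)%:R / (dprod d j)%:R).

(** The Cantor series, with positive terms, of the digit sequence [f]. *)
Definition cantor (R : realType) (d f : nat -> nat) : R :=
  limn (cantor_psum R d f).

Lemma cantor_psumE (R : realType) (d f : nat -> nat) (n : nat) :
  (forall n, (1 <= n)%N -> (2 <= d n)%N) ->
  cantor_psum R d f n = (cantor_num d f n)%:R / (dprod d n)%:R.
Proof.
move=> hd; elim: n => [|n IHn].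
  by rewrite /cantor_psum big_geq // mul0r.
rewrite /cantor_psum big_nat_recr //= -/(cantor_psum R d f n) IHn dprodS.
rewrite natrD !natrM; field.
have hdn : (0 < d n.+1)%N by apply: ltn_trans (hd _ _).
by rewrite pnatr_eq0 -lt0n hdn gt_eqF ?dprod_gt0.
Qed.

Lemma cantor_psum_homo (R : realType) (d f : nat -> nat) :
  {homo cantor_psum R d f : n m / (n <= m)%N >-> n <= m}.
Proof.
apply: homo_leq => // [|n]; first exact: le_trans.
by rewrite /cantor_psum [leRHS]big_nat_recr //= lerDl divr_ge0.
Qed.

(** In terms of partial sums [s], with [k = n + j]: the partial sum [s k] is at
most [s n + 1 / dprod d n - 1 / dprod d k]. *)
Lemma cantor_num_le (d f : nat -> nat) (n j : nat) : digits d f ->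
  (cantor_num d f (n + j) * dprod d n + dprod d n <=
   (cantor_num d f n).+1 * dprod d (n + j))%N.
Proof.
move=> hf; elim: j => [|j IHj]; first by rewrite addn0; nia.
have hfn : (f (n + j).+1 < d (n + j).+1)%N by exact: hf.
rewrite addnS /= dprodS; nia.
Qed.

(** The partial sums after rank [n] do not exceed the right end of the cell
that the first [n] digits determine. *)
Lemma cantor_psum_le (R : realType) (d f : nat -> nat) (n k : nat) :
  (forall n, (1 <= n)%N -> (2 <= d n)%N) -> digits d f -> (n <= k)%N ->
  cantor_psum R d f k <= (cantor_num d f n).+1%:R / (dprod d n)%:R.
Proof.
move=> hd hf /subnKC <-; move: (k - n)%N => j.
rewrite cantor_psumE // ler_pdivrMr ?dprod_gt0 // mulrAC.
rewrite ler_pdivlMr ?dprod_gt0 // -!natrM ler_nat.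
exact: leq_trans (leq_addr _ _) (cantor_num_le _ _ _ _ hf).
Qed.

Lemma is_cvg_cantor (R : realType) (d f : nat -> nat) :
  (forall n, (1 <= n)%N -> (2 <= d n)%N) -> digits d f ->
  cvgn (cantor_psum R d f).
Proof.
move=> hd hf; apply: nondecreasing_is_cvgn; first exact: cantor_psum_homo.
exists ((cantor_num d f 0).+1%:R / (dprod d 0)%:R) => _ [n _ <-].
exact: cantor_psum_le.
Qed.

Lemma cantor_itv (R : realType) (d f : nat -> nat) (n : nat) :
  (forall n, (1 <= n)%N -> (2 <= d n)%N) -> digits d f ->
  (cantor_num d f n)%:R / (dprod d n)%:R <= cantor R d f
    <= (cantor_num d f n).+1%:R / (dprod d n)%:R.
Proof.
move=> hd hf; have cf := is_cvg_cantor R _ _ hd hf; apply/andP; split.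
  rewrite -cantor_psumE //; apply: nondecreasing_cvgn_le cf _.
  exact: cantor_psum_homo.
apply: limr_le cf _; exists n => // k nk; exact: cantor_psum_le.
Qed.

(** Every [x] with [0 <= x < 1] is the sum of a Cantor series; its digits are
those of the integers [Num.truncn (x * dprod d n)]. *)
Lemma cantor_truncn (R : realType) (d : nat -> nat) (x : R) :
  (forall n, (1 <= n)%N -> (2 <= d n)%N) -> 0 <= x < 1 ->
  exists f : nat -> nat, [/\ digits d f, x = cantor R d f &
    forall n, cantor_num d f n = Num.truncn (x * (dprod d n)%:R)].
Proof.
move=> hd /andP[x0 x1]; pose q n := Num.truncn (x * (dprod d n)%:R).
have xP0 n : 0 <= x * (dprod d n)%:R by rewrite mulr_ge0.
have qS n : (q n.+1 %/ d n.+1)%N = q n.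
  have hdn : (0 < d n.+1)%N by apply: ltn_trans (hd _ _).
  have := truncnS_gt (x * (dprod d n)%:R); have := truncn_le (x * (dprod d n)%:R).
  rewrite xP0 -/(q n) => qlo qhi.
  have dR : 0 < (d n.+1)%:R :> R by rewrite ltr0n.
  have qS_lt : (q n.+1 < (q n).+1 * d n.+1)%N.
    by rewrite {1}/q truncn_lt_nat // dprodS !natrM mulrA ltr_pM2r.
  have qS_ge : (q n * d n.+1 <= q n.+1)%N.
    by rewrite [leqRHS]/q truncn_ge_nat // dprodS !natrM mulrA ler_pM2r.
  by apply/eqP; rewrite eqn_leq -ltnS ltn_divLR // leq_divRL // qS_lt.
exists (fun n => q n %% d n)%N.
have df : digits d (fun n => q n %% d n)%N.
  by move=> n n0; rewrite ltn_pmod // (leq_trans _ (hd _ n0)).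
have numE n : cantor_num d (fun n => q n %% d n)%N n = q n.
  elim: n => [|n /= ->]; last by rewrite -(qS n) -divn_eq.
  apply/esym/eqP; rewrite -leqn0 -ltnS /q truncn_lt_nat //.
  by rewrite dprod0 mulr1.
split=> //; apply/esym/(@cvg_lim R) => //.
apply: (@squeeze_cvgr _ _ _ _ (fun n => x - ((dprod d n)%:R)^-1) (fun=> x)).
- apply: nearW => n; rewrite cantor_psumE // numE.
  have P0 := dprod_gt0 R d n hd.
  rewrite ler_pdivrMr // truncn_le xP0 andbT ler_pdivlMr //.
  rewrite mulrBl mulVf ?gt_eqF // lerBlDr.
  by rewrite /q natr1 ltW // truncnS_gt.
- rewrite -[X in _ --> X]subr0; apply: cvgB; first exact: cvg_cst.
  exact: cvg_invr_dprod.
- exact: cvg_cst.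
Qed.


(** * Counting the admissible prefixes *)

(** Numerators of the cylinders of rank [n] of the representations whose
[j]-th digit belongs to [A j] for every [j] from 1 to [n]. *)
Fixpoint cyl_nums (d : nat -> nat) (A : nat -> seq nat) (n : nat) : seq nat :=
  if n is n'.+1 then
    [seq (a * d n + c)%N | a <- cyl_nums d A n', c <- A n]
  else [:: 0%N].

Lemma eq_divn_mod (p a b c e : nat) : (c < p)%N -> (e < p)%N ->
  (a * p + c = b * p + e)%N -> a = b /\ c = e.
Proof.
move=> cp ep abce.
have ab : a = b.
  have := congr1 (divn^~ p) abce.
  by rewrite !divnMDl ?(leq_ltn_trans _ cp) // !divn_small // !addn0.
by split=> //; move: abce; rewrite ab => /addnI.
Qed.

Lemma size_cyl_nums (d : nat -> nat) (A : nat -> seq nat) (n : nat) :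
  size (cyl_nums d A n) = (\prod_(1 <= j < n.+1) size (A j))%N.
Proof.
elim: n => [|n IHn]; first by rewrite big_geq.
by rewrite /= size_allpairs IHn [RHS]big_nat_recr.
Qed.

Lemma uniq_cyl_nums (d : nat -> nat) (A : nat -> seq nat) (n : nat) :
  (forall j, (1 <= j)%N -> uniq (A j)) ->
  (forall j, (1 <= j)%N -> {in A j, forall c, (c < d j)%N}) ->
  uniq (cyl_nums d A n).
Proof.
move=> uA hA; elim: n => [//|n IHn] /=; apply: allpairs_uniq => //; first exact: uA.
move=> _ _ /allpairsP[[a c] [_ /= cA ->]] /allpairsP[[b e] [_ /= eA ->]] /=.
by move=> /eq_divn_mod[]; [exact: hA|exact: hA|move=> -> ->].
Qed.

Lemma cyl_nums_lt (d : nat -> nat) (A : nat -> seq nat) (n a : nat) :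
  (forall j, (1 <= j)%N -> {in A j, forall c, (c < d j)%N}) ->
  a \in cyl_nums d A n -> (a < dprod d n)%N.
Proof.
move=> hA; elim: n a => [|n IHn] a; first by rewrite inE dprod0 => /eqP ->.
rewrite dprodS => /allpairsP[[b c] [/IHn /= bP cA ->]].
have cd : (c < d n.+1)%N by exact: hA cA.
nia.
Qed.

Lemma cyl_numsP (d : nat -> nat) (A : nat -> seq nat) (f : nat -> nat) (n : nat) :
  (forall j, (1 <= j)%N -> {in A j, forall c, (c < d j)%N}) -> digits d f ->
  cantor_num d f n \in cyl_nums d A n <->
  forall j, (1 <= j <= n)%N -> f j \in A j.
Proof.
move=> hA hf; elim: n => [|n IHn].
  by split=> // _ j /andP[]; case: j.
split=> [/allpairsP[[b c] [/= bn cA]]|fA].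
  move=> /eq_divn_mod[]; [exact: hf|exact: hA cA|move=> bE cE j /andP[j1]].
  rewrite leq_eqVlt => /predU1P[-> //|jn]; first by rewrite cE.
  by move: bn; rewrite -bE => /IHn; apply; rewrite j1.
apply/allpairsP; exists (cantor_num d f n, f n.+1); split=> //=.
- by apply/IHn => j /andP[j1 jn]; apply: fA; rewrite j1 leqW.
- by apply: fA; rewrite /= leqnn.
Qed.

(** * The measure of a set with confined digits *)

(** Distinct half-open cells of a grid of step [1 / P] are disjoint. *)
Lemma measure_grid (R : realType) (t P : R) (s : seq nat) :
  0 < P -> uniq s ->
  let U := [set y : R | exists2 a : nat, a \in s &
                         t + a%:R / P <= y < t + a.+1%:R / P] in
  measurable U /\ lebesgue_measure U = ((size s)%:R / P)%:E.
Proof.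
move=> P0; elim: s => [_|a s IHs].
  rewrite /= mul0r (_ : [set _ | _] = set0) ?measure0//.
  by apply/seteqP; split=> // y [].
move=> /= /andP[aNs /IHs /= [mU lU]].
set U := [set _ | _] in mU lU.
rewrite (_ : [set _ | _] = `[t + a%:R / P, t + a.+1%:R / P[%classic `|` U).
  split; first exact: measurableU.
  rewrite measureU //; last first.
    apply/seteqP; split=> // y [/=]; rewrite in_itv /= => /andP[ay ya].
    move=> [b bs /andP[yb b_y]]; move: aNs; rewrite (_ : a = b) ?bs //.
    have h1 := le_lt_trans ay b_y; have h2 := le_lt_trans yb ya.
    rewrite !ltrD2l !ltr_pM2r ?invr_gt0 // !ltr_nat in h1 h2.
    by apply/eqP; rewrite eqn_leq -ltnS h1 -ltnS h2.
  rewrite [X in (X + _)%E]lebesgue_measure_itv [X in (_ + X)%E]lU /= lte_fin.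
  rewrite ltrD2l ltr_pM2r ?invr_gt0 // ltr_nat ltnSn -EFinB -EFinD.
  by congr EFin; rewrite -[a.+1]addn1 -[(size s).+1]addn1 !natrD; field; rewrite gt_eqF.
apply/seteqP; split=> y /=.
  move=> [b]; rewrite inE => /predU1P[->|bs] yb; first by left; rewrite in_itv.
  by right; exists b.
case=> [|[b bs yb]]; last by exists b => //; rewrite inE bs orbT.
by rewrite in_itv /= => ya; exists a => //; rewrite mem_head.
Qed.

(** The digit of rank [j] is confined to [A j], for [j] from 1 to [N]. The set
[S] contains the union of the half-open cells with admissible numerators, and
exceeds it by right endpoints of such cells only. *)
Lemma measure_cantor_cylinder (R : realType) (d : nat -> nat)
    (A : nat -> seq nat) (N : nat) (t : R) (S : set R) :
  (forall n, (1 <= n)%N -> (2 <= d n)%N) ->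
  (forall j, (1 <= j)%N -> uniq (A j)) ->
  (forall j, (1 <= j)%N -> {in A j, forall c, (c < d j)%N}) ->
  (forall x, S x <-> t <= x <= t + 1 /\ exists f : nat -> nat,
     [/\ digits d f, x = t + cantor R d f &
         forall j, (1 <= j <= N)%N -> f j \in A j]) ->
  measurable S /\ lebesgue_measure S =
    (\prod_(1 <= j < N.+1) ((size (A j))%:R / (d j)%:R))%:E.
Proof.
move=> hd uA hA SP; have P0 := dprod_gt0 R d N hd; set P := (dprod d N)%:R in P0.
pose s := cyl_nums d A N.
have [] := @measure_grid R t P s P0 (uniq_cyl_nums d A N uA hA).
set U := [set _ | _] => mU lU.
have US : U `<=` S.
  move=> y [a /[dup] as_ /(cyl_nums_lt _ _ _ _ hA) aP /andP[ay ya]].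
  rewrite -lerBrDl ler_pdivrMr // in ay.
  rewrite -ltrBlDl ltr_pdivlMr // in ya.
  have x01 : 0 <= y - t < 1.
    rewrite -(pmulr_lge0 _ P0) (le_trans _ ay) //=.
    by rewrite -(ltr_pM2r P0) mul1r (lt_le_trans ya) // ler_nat.
  have [f [hf xE fE]] := cantor_truncn R d (y - t) hd x01.
  apply/SP; split; first by case/andP: x01 => ? ?; apply/andP; split; lra.
  exists f; split=> //; first by rewrite -xE; ring.
  apply/(cyl_numsP _ _ _ _ hA hf); rewrite fE.
  by rewrite (@truncn_def _ _ a) // ay ya.
have SU : S `\` U `<=` [set t + a.+1%:R / P | a in [set` s]].
  move=> x [/SP[_ [f [hf xE fA]]] xNU]; exists (cantor_num d f N) => /=.
    exact/cyl_numsP.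
  have /andP[lo hi] := cantor_itv R d f N hd hf.
  apply/eqP; rewrite xE eq_le !lerD2l hi andbT leNgt; apply/negP => lt.
  apply: xNU; exists (cantor_num d f N); first exact/cyl_numsP.
  by rewrite xE lerD2l ltrD2l lo.
have cSU : countable (S `\` U).
  apply/finite_set_countable/(sub_finite_set SU)/finite_image/finite_seq.
have mSU : measurable (S `\` U).
  by apply: countable_measurable => // y; exact: measurable_set1.
rewrite -(setDUK US); split; first exact: measurableU.
rewrite measureU0 //; last exact: countable_lebesgue_measure0.
rewrite [LHS]lU size_cyl_nums; congr EFin.
by rewrite /P /dprod !natr_prod -prodfV -big_split.
Qed.

(** * From alternating to positive series *)

(** The digit [c] of rank [n], complemented to [d n - 1] when [n] is odd. *)
Definition flip_digit (d : nat -> nat) (n c : nat) : nat :=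
  if odd n then (d n - c.+1)%N else c.

(** The digit sequence [e] with its digits of odd rank complemented. On digit
sequences this is an involution from rank 1 on. *)
Definition flip (d e : nat -> nat) : nat -> nat := fun n => flip_digit d n (e n).

Lemma flip_digit_lt (d : nat -> nat) (n c : nat) :
  (c < d n)%N -> (flip_digit d n c < d n)%N.
Proof. by rewrite /flip_digit; case: (odd n) => //; lia. Qed.

Lemma flip_digitK (d : nat -> nat) (n c : nat) :
  (c < d n)%N -> flip_digit d n (flip_digit d n c) = c.
Proof. by rewrite /flip_digit; case: (odd n) => //; lia. Qed.

Lemma digits_flip (d e : nat -> nat) : digits d e -> digits d (flip d e).
Proof. by move=> he n n1; apply/flip_digit_lt/he. Qed.

(** The flipped null sequence accounts for the terms [(d n - 1) / dprod d n] of
odd rank [n] that complementing adds. *)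
Lemma alternating_psumE (R : realType) (d e : nat -> nat) (N : nat) :
  (forall n, (1 <= n)%N -> (2 <= d n)%N) -> digits d e ->
  \sum_(1 <= n < N.+1) ((-1) ^+ n * (e n)%:R / (dprod d n)%:R) =
  cantor_psum R d (flip d e) N - cantor_psum R d (flip d (fun=> 0%N)) N.
Proof.
move=> hd he; rewrite -sumrB; apply: eq_big_nat => n /andP[n1 _].
rewrite -mulrBl /flip /flip_digit -signr_odd; congr (_ / _).
case: ifP => _; last by rewrite expr0 mul1r subr0.
rewrite !natrB ?he //; last exact: leq_trans (hd n n1).
by rewrite expr1 -[(e n).+1]addn1 natrD; ring.
Qed.

(** Since [(d n - 1) / dprod d n = 1 / dprod d n.-1 - 1 / dprod d n], the Cantor
series whose digits are [d n - 1] at the odd ranks and [0] elsewhere sums to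
[1 - a0]. *)
Lemma a0_psumE (R : realType) (d : nat -> nat) (N : nat) :
  (forall n, (1 <= n)%N -> (2 <= d n)%N) ->
  \sum_(1 <= n < N.+1) ((-1) ^+ n.+1 / (dprod d n)%:R : R) =
  1 - cantor_psum R d (flip d (fun=> 0%N)) N - (~~ odd N)%:R / (dprod d N)%:R.
Proof.
move=> hd; elim: N => [|N IHN].
  by rewrite /cantor_psum !big_geq // dprod0 /= divr1 subr0 subrr.
rewrite big_nat_recr //= IHN /cantor_psum [in RHS]big_nat_recr //=.
rewrite -/(cantor_psum R d (flip d (fun=> 0%N)) N) dprodS natrM.
rewrite /flip /flip_digit -(signr_odd _ N.+2) /=.
have P0 := dprod_gt0 R d N hd.
have hdn : (2 <= d N.+1)%N by exact: hd.
have dR0 : 0 < (d N.+1)%:R :> R by rewrite ltr0n; lia.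
case: (odd N) => /=; rewrite ?expr1 ?expr0; last first.
  rewrite natrB; last by lia.
  by field; rewrite !gt_eqF.
by field; rewrite !gt_eqF.
Qed.

Lemma a0E (R : realType) (d : nat -> nat) :
  (forall n, (1 <= n)%N -> (2 <= d n)%N) ->
  a0 R d = 1 - cantor R d (flip d (fun=> 0%N)).
Proof.
move=> hd; rewrite /a0; under eq_fun do rewrite a0_psumE //.
apply: (@cvg_lim R) => //; rewrite -[X in _ --> X]subr0; apply: cvgB.
  apply: cvgB; first exact: cvg_cst.
  apply: is_cvg_cantor => //; apply: digits_flip => n n1.
  by apply: leq_trans (hd n n1).
apply: (@squeeze_cvgr _ _ _ _ (fun=> 0) (fun n => ((dprod d n)%:R)^-1)).
- apply: nearW => n; rewrite divr_ge0 //=.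
  by rewrite ler_piMl ?invr_ge0 // lern1; case: odd.
- exact: cvg_cst.
- exact: cvg_invr_dprod.
Qed.

Lemma negDE (R : realType) (d e : nat -> nat) :
  (forall n, (1 <= n)%N -> (2 <= d n)%N) -> digits d e ->
  negD R d e = a0 R d - 1 + cantor R d (flip d e).
Proof.
move=> hd he; rewrite a0E //.
rewrite (_ : 1 - _ - 1 + _ = cantor R d (flip d e) -
  cantor R d (flip d (fun=> 0%N))); last by ring.
rewrite /negD; under eq_fun do rewrite alternating_psumE //.
apply: (@cvg_lim R) => //.
have h0 : digits d (fun=> 0%N) by move=> n n1; apply: leq_trans (hd n n1).
by apply: cvgB; apply: is_cvg_cantor => //; exact: digits_flip.
Qed.

(** * Prescribing digits *)

Theorem lemma19 (R : realType) (d : nat -> nat)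
    (hd : forall n : nat, (1 <= n)%N -> (2 <= d n)%N)
    (m : nat) (hm : (1 <= m)%N) (k c : 'I_m -> nat)
    (hk0 : forall i : 'I_m, (0 < k i)%N)
    (hk : forall i j : 'I_m, (i < j)%N -> (k i < k j)%N)
    (hc : forall i : 'I_m, (c i < d (k i))%N) :
  measurable (Delta_set R d k c) /\
  lebesgue_measure (Delta_set R d k c) =
    (\prod_(i < m) (1 / (d (k i))%:R : R))%:E.
Proof.
have k_inj : injective k.
  move=> i j kij; apply: val_inj.
  by case: (ltngtP i j) => // /hk; rewrite kij ltnn.
(* [A j] lists the digits [b] allowed at rank [j] after complementation: a
   single one when [j] is some [k i], all of them otherwise. *)
pose A j := [seq b <- iota 0 (d j) |
  [forall i, (k i == j) ==> (flip_digit d j b == c i)]].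
have AP j b : b \in A j <->
    (b < d j)%N /\ forall i, k i = j -> flip_digit d j b = c i.
  rewrite mem_filter mem_iota /= add0n andbC; split.
    move=> /andP[-> /forallP h]; split=> // i kij.
    by have /implyP := h i; rewrite kij eqxx => /(_ isT)/eqP.
  by case=> -> h; apply/forallP => i; apply/implyP => /eqP/h ->.
have uA j : uniq (A j) by rewrite filter_uniq ?iota_uniq.
have size_A_k i : size (A (k i)) = 1%N.
  rewrite (@perm_size _ _ [:: flip_digit d (k i) (c i)]) //.
  apply: uniq_perm => // b; rewrite inE; apply/idP/eqP.
    by move=> /AP[bd /(_ i erefl) <-]; rewrite flip_digitK.
  move=> ->; apply/AP; split; first exact: flip_digit_lt.
  by move=> i' /k_inj ->; rewrite flip_digitK.
have size_A_free j : j \notin codom k -> size (A j) = d j.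
  move=> jk; rewrite /A (@eq_in_filter _ _ predT) ?filter_predT ?size_iota //.
  move=> b _; apply/forallP => i; apply/implyP => /eqP kij.
  by move: jk; rewrite -kij codom_f.
pose N := (\max_(i < m) k i)%N.
have kN i : (1 <= k i <= N)%N by rewrite hk0 leq_bigmax.
have [|||mS ->] := @measure_cantor_cylinder R d A N (a0 R d - 1) (Delta_set R d k c) hd.
- by move=> j _; exact: uA.
- by move=> j _ b /AP[].
- move=> x; rewrite /Delta_set /= subrK; split=> -[xI].
    move=> [e [he xE ek]]; split=> //; exists (flip d e).
    split; [exact: digits_flip|by rewrite xE negDE|move=> j /andP[j1 _]].
    apply/AP; split; first exact: (digits_flip _ _ he).
    by move=> i <-; rewrite flip_digitK ?ek.
  move=> [f [hf xE fA]]; split=> //; exists (flip d f).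
  have hff := digits_flip _ _ hf; split=> //.
    rewrite xE negDE //; congr (_ + limn _); apply/funext => n.
    by apply: eq_big_nat => j /andP[j1 _]; rewrite /flip flip_digitK ?hf.
  by move=> i; have /AP[_] := fA _ (kN i); apply.
split=> //; congr EFin.
(* The factors of unprescribed rank are [d j / d j = 1]; the others are
   reindexed by the injection [k]. *)
rewrite (bigID (mem (codom k))) /= [X in _ * X]big1_seq ?mulr1; last first.
  move=> j /andP[jk]; rewrite mem_index_iota => /andP[j1 _].
  by rewrite size_A_free // divff // pnatr_eq0 -lt0n (leq_trans _ (hd j j1)).
rewrite -big_filter (perm_big (codom k)); last first.
  apply: uniq_perm; first by rewrite filter_uniq ?iota_uniq.
    by apply/injectiveP.
  move=> j; rewrite mem_filter mem_index_iota /= andb_idr //.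
  by move=> /codomP[i ->]; rewrite ltnS.
by rewrite codomE big_map big_enum; apply: eq_bigr => i _; rewrite size_A_k.
Qed.
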